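(* Let $\lambda\ge 0$, let $(x_i,y_i)_{i=1}^n$ be training data with $x_i\in\mathbb{R}^d$, $\|x_i\|\le 1$, $y_i\in\{-1,1\}$, and let $f_\theta(x)=\langle w_K, W_{K-1}\cdots W_1 x\rangle$ be a deep linear network with $K$ layers and parameter vector $\theta=(\mathrm{vec}(W_1),\dots,\mathrm{vec}(W_{K-1}),w_K)$. Let $L(\theta)=\frac1n\sum_{i=1}^n \ell(y_i f_\theta(x_i))$ with the logistic loss $\ell(z)=\ln(1+e^{-z})$. If $\theta$ satisfies the alignment condition $\lambda\theta=-\nabla L(\theta)$, then all weight matrices $W_1,\dots,W_{K-1}$ are rank-1.
   Context: Here $W_1\in\mathbb{R}^{m\times d}$, $W_k\in\mathbb{R}^{m\times m}$ for $2\le k\le K-1$, and $w_K\in\mathbb{R}^m$. The setting is training with weight decay ($L2$ regularization) with parameter $\lambda$: the alignment condition says that $\theta$ is a stationary point of the regularized loss $L_\lambda(\theta)=L(\theta)+\frac{\lambda}{2}\|\theta\|_2^2$.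
   Formalization: λ > 0 is assumed in place of λ ≥ 0, since the claim fails for λ = 0 (e.g. W_1 = I, w_2 = 0, x_1 = x_2, y_1 = 1, y_2 = -1); ''rank-1'' means rank at most 1 for every aligned θ and exactly 1 for θ ≠ 0, since θ = 0 is aligned with rank 0. *)

(* Defs.v *)
From HB Require Import structures.
From mathcomp Require Import all_boot all_order all_algebra.
From mathcomp Require Import all_classical all_reals all_analysis.

Set Implicit Arguments.
Unset Strict Implicit.
Unset Printing Implicit Defensive.

Import Order.TTheory GRing.Theory Num.Theory.
Import numFieldNormedType.Exports.

Local Open Scope ring_scope.

Definition dotv (R : realType) (p : nat) (u v : 'cV[R]_p) : R :=
  \sum_(i < p) u i 0 * v i 0.

(* The norm carried by the library's matrices is the sup norm, so the Euclidean
   one is defined separately. *)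
Definition l2norm (R : realType) (p : nat) (u : 'cV[R]_p) : R :=
  Num.sqrt (dotv u u).

(* The parameter space of a network with K >= 2 layers, as R^p with coordinates
   (vec W_1, (vec W_2, ..., vec W_(K-1)), w_K): there are K - 2 square matrices
   between the first layer and the output vector. The vectorization is the
   library's row-major [mxvec]. *)
Definition nparams (d m K : nat) : nat :=
  (m * d + (K.-2 * (m * m) + m))%N.

Definition W_first (R : realType) (d m K : nat)
    (theta : 'rV[R]_(nparams d m K)) : 'M[R]_(m, d) :=
  vec_mx (lsubmx theta).

(* [W_mid theta j] is W_(j+2), for 0 <= j < K - 2. *)
Definition W_mid (R : realType) (d m K : nat)
    (theta : 'rV[R]_(nparams d m K)) (j : 'I_K.-2) : 'M[R]_m :=
  vec_mx (row j (vec_mx (lsubmx (rsubmx theta)))).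

Definition w_last (R : realType) (d m K : nat)
    (theta : 'rV[R]_(nparams d m K)) : 'cV[R]_m :=
  (rsubmx (rsubmx theta))^T.

(* The product W_(K-1) ... W_1; [enum 'I_K.-2] is increasing, so W_2 is applied
   right after W_1. *)
Definition weight_prod (R : realType) (d m K : nat)
    (theta : 'rV[R]_(nparams d m K)) : 'M[R]_(m, d) :=
  foldl (fun A j => W_mid theta j *m A) (W_first theta) (enum 'I_K.-2).

Definition deep_linear (R : realType) (d m K : nat)
    (theta : 'rV[R]_(nparams d m K)) (x : 'cV[R]_d) : R :=
  dotv (w_last theta) (weight_prod theta *m x).

Definition logistic (R : realType) (z : R) : R := ln (1 + expR (- z)).

Definition emp_loss (R : realType) (d m K n : nat)
    (x : 'I_n -> 'cV[R]_d) (y : 'I_n -> R)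
    (theta : 'rV[R]_(nparams d m K)) : R :=
  n%:R^-1 * \sum_(i < n) logistic (y i * deep_linear theta (x i)).

Definition gradient (R : realType) (p : nat) (f : 'rV[R]_p -> R)
    (a : 'rV[R]_p) : 'rV[R]_p :=
  \row_(j < p) 'D_(delta_mx 0 j) f a.

Definition aligned (R : realType) (d m K n : nat) (lambda : R)
    (x : 'I_n -> 'cV[R]_d) (y : 'I_n -> R)
    (theta : 'rV[R]_(nparams d m K)) : Prop :=
  lambda *: theta = - gradient (emp_loss x y) theta.

(* Main.v *)
(** With the other layers fixed, the output is [P *m W *m M *m x] for a row [P],
    so the gradient of the loss in [W] is [P^T] times a row vector; stationarity
    makes [lambda *: W] equal to minus this outer product. Pairing with [W]
    itself (Euler's identity) gives [lambda * |W|^2 = - sum_i s_i f(x_i)], where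
    [s_i] is the derivative of the loss in the output at [x_i]. The right-hand
    side does not depend on the layer, so all layers have the same Frobenius
    norm, and either all vanish or none does. *)
Require Import Defs.
From HB Require Import structures.
From mathcomp Require Import all_boot all_order all_algebra.
From mathcomp Require Import all_classical all_reals all_analysis.

Set Implicit Arguments.
Unset Strict Implicit.
Unset Printing Implicit Defensive.

Import Order.TTheory GRing.Theory Num.Theory.
Import numFieldNormedType.Exports.

Local Open Scope ring_scope.

(** * Directional derivatives of the empirical loss *)

Lemma is_derive_logistic (R : realType) (z : R) :
  is_derive z 1 (@logistic R) ((@logistic R)^`()%classic z).
Proof.
rewrite derive1E; apply: DeriveDef => //; rewrite /logistic.
have pos : 0 < 1 + expR (- z) by rewrite addr_gt0 ?ltr01 ?expR_gt0.
have dln := is_derive1_ln pos.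
by apply: (@ex_derive _ _ _ _ _ _ _
  (@is_derive1_comp _ _ (fun t => 1 + expR (- t)) z _ _ dln _)).
Qed.

(** The output is linear in each layer separately, hence affine along every coordinate direction;
    the chain rule is then needed only for a function [g] of one real variable. *)
Lemma derive_emp_loss_affine (R : realType) (d m K n : nat)
    (x : 'I_n -> 'cV[R]_d) (y : 'I_n -> R)
    (theta v : 'rV[R]_(nparams d m K)) (c : 'I_n -> R) :
  (forall i h, deep_linear (theta + h *: v) (x i)
               = deep_linear theta (x i) + h * c i) ->
  'D_v (emp_loss x y) theta =
    \sum_(i < n)
      n%:R^-1 * ((@logistic R)^`()%classic (y i * deep_linear theta (x i)) * y i)
        * c i.
Proof.
move=> affine.
pose g (h : R) := n%:R^-1 * \sum_(i < n)
  logistic (y i * (deep_linear theta (x i) + h * c i)).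
have -> : 'D_v (emp_loss x y) theta = 'D_1 g 0.
  (* The two difference quotients agree pointwise, so their limits agree without any
     differentiability argument. *)
  rewrite /derive.
  suff -> : (fun h : R =>
        h^-1 *: ((emp_loss x y \o shift theta) (h *: v) - emp_loss x y theta))
      = (fun h : R => h^-1 *: ((g \o shift 0) (h *: 1) - g 0)) by [].
  apply/funext => h /=; rewrite /emp_loss /g /shift /= addr0.
  congr (_ *: (_ * _ - _ * _)); apply: eq_bigr => i _.
    by rewrite addrC affine /GRing.scale /= mulr1.
  by rewrite mul0r addr0.
apply: derive_val.
have -> : g = n%:R^-1 \*: (\sum_(i < n) (@logistic R \o
    (fun h => y i * (deep_linear theta (x i) + h * c i)))).
  by apply/funext => h /=; rewrite /g fct_sumE.
under [X in is_derive _ _ _ X]eq_bigr do rewrite -!mulrA.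
rewrite -mulr_sumr.
apply: is_deriveZ; apply: is_derive_sum => i.
apply: is_derive1_comp.
  rewrite mul0r addr0; exact: is_derive_logistic.
have -> : (fun h : R => y i * (deep_linear theta (x i) + h * c i)) =
  (cst (y i * deep_linear theta (x i)) + (y i * c i) \*: (@id R)).
  apply/funext => h /=; rewrite mulrDr /GRing.scale /= /GRing.add /=.
  by congr (_ + _); rewrite mulrCA mulrC.
(* The value takes the shape [0 + (y i * c i) * 1]: a constant plus a multiple of the identity. *)
rewrite -[X in is_derive _ _ _ X]add0r -[X in is_derive _ _ _ (_ + X)]mulr1.
exact: is_deriveD.
Qed.

(** * Matrix units and the Frobenius norm *)

Lemma mulmx_delta_mulmx (R : pzSemiRingType) (p q : nat) (P : 'rV[R]_p)
    (k : 'I_p) (l : 'I_q) (z : 'cV[R]_q) :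
  (P *m delta_mx k l *m z) 0 0 = P 0 k * z l 0.
Proof.
rewrite -(mul_delta_mx (0 : 'I_1)) mulmxA -mulmxA -colE -rowE.
by rewrite !mxE big_ord1 !mxE.
Qed.

Lemma mxtrace_mul_tr (R : pzRingType) (p q : nat) (W : 'M[R]_(p, q)) :
  \tr (W *m W^T) = \sum_i \sum_j W i j ^+ 2.
Proof.
by rewrite /mxtrace; apply: eq_bigr => i _; rewrite mxE; apply: eq_bigr => j _;
   rewrite mxE expr2.
Qed.

(** The trace is the squared Frobenius norm, a sum of squares, so it vanishes only when every entry
    does. *)
Lemma mxtrace_mul_tr_eq0 (R : realDomainType) (p q : nat) (W : 'M[R]_(p, q)) :
  (\tr (W *m W^T) == 0) = (W == 0).
Proof.
apply/eqP/eqP => [|->]; last by rewrite mul0mx mxtrace0.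
rewrite mxtrace_mul_tr => /eqP.
rewrite psumr_eq0 => [/allP W0|i _]; last first.
  by apply: sumr_ge0 => j _; exact: sqr_ge0.
apply/matrixP => i j; have /= := W0 i (mem_index_enum i).
rewrite psumr_eq0 => [/allP/(_ j (mem_index_enum j))|? _]; last exact: sqr_ge0.
by rewrite /= sqrf_eq0 mxE => /eqP.
Qed.

(* [P *m W *m M] is the network seen from one layer [W], whose entries sit at
   the coordinates [idx] of [theta]. *)
Lemma aligned_block (R : realType) (d m K n p q : nat) (lambda : R)
    (x : 'I_n -> 'cV[R]_d) (y : 'I_n -> R)
    (theta : 'rV[R]_(nparams d m K)) (W : 'M[R]_(p, q))
    (idx : 'I_p -> 'I_q -> 'I_(nparams d m K))
    (P : 'rV[R]_p) (M : 'M[R]_(q, d)) :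
  aligned lambda x y theta ->
  (forall k l, W k l = theta 0 (idx k l)) ->
  (forall z, deep_linear theta z = (P *m W *m (M *m z)) 0 0) ->
  (forall k l h z, deep_linear (theta + h *: delta_mx 0 (idx k l)) z
                   = (P *m (W + h *: delta_mx k l) *m (M *m z)) 0 0) ->
  (exists u : 'rV[R]_q, lambda *: W = P^T *m u) /\
  lambda * \tr (W *m W^T) = - \sum_(i < n)
    n%:R^-1 * ((@logistic R)^`()%classic (y i * deep_linear theta (x i)) * y i)
      * deep_linear theta (x i).
Proof.
move=> al Widx net0 net1.
pose s i : R :=
  n%:R^-1 * ((@logistic R)^`()%classic (y i * deep_linear theta (x i)) * y i).
(* [M *m x i] is the input that the layer receives from sample [i]; the sign is that of the descent
   direction. *)
pose u := - \sum_i s i *: (M *m x i).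
have WE : lambda *: W = P^T *m u^T.
  apply/matrixP => k l; rewrite mxE Widx.
  move/rowP: al => /(_ (idx k l)); rewrite mxE => ->; rewrite !mxE.
  rewrite (@derive_emp_loss_affine _ _ _ _ _ _ _ _ _
    (fun i => P 0 k * (M *m x i) l 0)); last first.
    move=> i h; rewrite net1 net0 mulmxDr mulmxDl mxE; congr (_ + _).
    by rewrite -scalemxAr -scalemxAl mxE mulmx_delta_mulmx.
  rewrite big_ord1 !mxE summxE mulrN mulr_sumr; congr (- _).
  by apply: eq_bigr => i _; rewrite -/(s i) [in RHS]mxE mulrCA.
split; first by exists u^T.
(* Euler's identity: pairing the outer product with [W] gives the scalar [P *m W *m u], in which
   each [P *m W *m (M *m x i)] is the network output. *)
rewrite -mxtraceZ scalemxAl WE mxtrace_mulC.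
have -> : \tr (W^T *m (P^T *m u^T)) = \tr (P *m W *m u).
  by rewrite -mxtrace_tr !trmx_mul !trmxK -mulmxA mxtrace_mulC.
rewrite trace_mx11 mulmxN mulmx_sumr mxE summxE; congr (- _).
by apply: eq_bigr => i _; rewrite -scalemxAr mxE -net0.
Qed.

(** * Isolating one factor of the product of layers *)

Lemma foldl_mulmx (R : pzSemiRingType) (m d : nat) (I : Type)
    (B : I -> 'M[R]_m) (A : 'M[R]_(m, d)) (s : seq I) :
  foldl (fun A j => B j *m A) A s
  = foldl (fun A j => B j *m A) 1%:M s *m A.
Proof.
(* The accumulator changes along the fold, so the induction needs an arbitrary left factor [C]. *)
have gen e (C : 'M[R]_(m, e)) (A' : 'M[R]_(e, d)) :
    foldl (fun A j => B j *m A) (C *m A') s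
    = foldl (fun A j => B j *m A) C s *m A'.
  by elim: s C => //= j s IHs C; rewrite mulmxA IHs.
by rewrite -gen mul1mx.
Qed.

Lemma eq_in_foldl (I : eqType) (T : Type) (f g : T -> I -> T) (z : T)
    (s : seq I) :
  (forall a, {in s, f a =1 g a}) -> foldl f z s = foldl g z s.
Proof.
elim: s z => //= j s IHs z fg; rewrite fg ?mem_head //; apply: IHs => a i si.
by apply: fg; rewrite in_cons si orbT.
Qed.

(** [L] and [N] are chosen before [B'], so the same two factors serve both the original network and
    its perturbation in layer [j]. Uniqueness of [s] keeps [j] out of both. *)
Lemma foldl_mulmx_factor (R : pzSemiRingType) (m d : nat) (I : eqType)
    (B : I -> 'M[R]_m) (A : 'M[R]_(m, d)) (s : seq I) (j : I) :
  uniq s -> j \in s ->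
  exists (L : 'M[R]_m) (N : 'M[R]_(m, d)), forall B' : I -> 'M[R]_m,
    (forall i, i != j -> B' i = B i) ->
    foldl (fun A j => B' j *m A) A s = L *m B' j *m N.
Proof.
move=> + js; case/splitPr: js => s1 s2.
rewrite cat_uniq /= => /and3P[_ /norP[js1 _] /andP[js2 _]].
exists (foldl (fun A j => B j *m A) 1%:M s2).
exists (foldl (fun A j => B j *m A) A s1) => B' B'E.
have agree e (C : 'M[R]_(m, e)) s' : j \notin s' ->
    foldl (fun A j => B' j *m A) C s' = foldl (fun A j => B j *m A) C s'.
  move=> js'; apply: eq_in_foldl => D i is'.
  by rewrite B'E //; apply: contraNneq js' => <-.
by rewrite foldl_cat /= foldl_mulmx !agree // mulmxA.
Qed.

(** * Coordinates of the layers in the parameter vector *)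

Section Blocks.
Variables (R : realType) (d m K : nat).
Implicit Types theta v : 'rV[R]_(nparams d m K).

Definition first_index (k : 'I_m) (l : 'I_d) : 'I_(nparams d m K) :=
  lshift _ (mxvec_index k l).

Definition mid_index (j : 'I_K.-2) (k l : 'I_m) : 'I_(nparams d m K) :=
  rshift (m * d) (lshift m (mxvec_index j (mxvec_index k l))).

Definition last_index (l : 'I_m) : 'I_(nparams d m K) :=
  rshift (m * d) (rshift (K.-2 * (m * m)) l).

Lemma W_firstE theta k l : W_first theta k l = theta 0 (first_index k l).
Proof. by rewrite !mxE. Qed.

Lemma W_midE theta j k l : W_mid theta j k l = theta 0 (mid_index j k l).
Proof. by rewrite !mxE. Qed.

Lemma w_lastE theta l : (w_last theta) l 0 = theta 0 (last_index l).
Proof. by rewrite !mxE. Qed.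

Lemma W_firstD theta v h :
  W_first (theta + h *: v) = W_first theta + h *: W_first v.
Proof. by rewrite /W_first !linearD !linearZ. Qed.

Lemma W_midD theta v h j :
  W_mid (theta + h *: v) j = W_mid theta j + h *: W_mid v j.
Proof. by rewrite /W_mid !linearD !linearZ. Qed.

Lemma w_lastD theta v h :
  w_last (theta + h *: v) = w_last theta + h *: w_last v.
Proof. by rewrite /w_last !linearD !linearZ. Qed.

Lemma W_first_delta k l :
  W_first (delta_mx 0 (first_index k l) : 'rV[R]_(nparams d m K))
  = delta_mx k l.
Proof. by rewrite /W_first delta_mx_lshift row_mxKl -mxvec_delta mxvecK. Qed.

Lemma W_first_rshift i :
  W_first (delta_mx 0 (rshift (m * d) i) : 'rV[R]_(nparams d m K)) = 0.
Proof. by rewrite /W_first delta_mx_rshift row_mxKl linear0. Qed.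

Lemma W_mid_delta j k l i :
  W_mid (delta_mx 0 (mid_index j k l) : 'rV[R]_(nparams d m K)) i
  = if i == j then delta_mx k l else 0.
Proof.
rewrite /W_mid delta_mx_rshift row_mxKr delta_mx_lshift row_mxKl.
rewrite -mxvec_delta mxvecK.
have -> : row i (delta_mx j (mxvec_index k l))
  = if i == j then delta_mx 0 (mxvec_index k l) else 0 :> 'rV[R]_(m * m).
  by apply/rowP => b; case: eqP => [->|/eqP/negPf ij]; rewrite !mxE ?eqxx ?ij.
by case: eqP => _; rewrite ?linear0 // -mxvec_delta mxvecK.
Qed.

Lemma W_mid_first k l i :
  W_mid (delta_mx 0 (first_index k l) : 'rV[R]_(nparams d m K)) i = 0.
Proof. by rewrite /W_mid delta_mx_lshift row_mxKr !linear0. Qed.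

Lemma W_mid_last l i :
  W_mid (delta_mx 0 (last_index l) : 'rV[R]_(nparams d m K)) i = 0.
Proof. by rewrite /W_mid !delta_mx_rshift row_mxKr row_mxKl !linear0. Qed.

Lemma w_last_delta l :
  w_last (delta_mx 0 (last_index l) : 'rV[R]_(nparams d m K)) = delta_mx l 0.
Proof. by rewrite /w_last !delta_mx_rshift !row_mxKr trmx_delta. Qed.

Lemma w_last_first k l :
  w_last (delta_mx 0 (first_index k l) : 'rV[R]_(nparams d m K)) = 0.
Proof. by rewrite /w_last delta_mx_lshift row_mxKr !linear0. Qed.

Lemma w_last_mid j k l :
  w_last (delta_mx 0 (mid_index j k l) : 'rV[R]_(nparams d m K)) = 0.
Proof.
by rewrite /w_last delta_mx_rshift row_mxKr delta_mx_lshift row_mxKr linear0.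
Qed.

(** The blocks exhaust the coordinates; this is what excludes vanishing layers when [theta] is
    nonzero. *)
Lemma blocks_eq0 theta :
  W_first theta = 0 -> (forall j, W_mid theta j = 0) -> w_last theta = 0 ->
  theta = 0.
Proof.
move=> first0 mid0 last0; rewrite -[theta]hsubmxK -[rsubmx theta]hsubmxK.
have -> : lsubmx theta = 0.
  by rewrite -[LHS]vec_mxK -[vec_mx _]/(W_first theta) first0 linear0.
have -> : rsubmx (rsubmx theta) = 0.
  by rewrite -[LHS]trmxK -/(w_last theta) last0 linear0.
suff -> : lsubmx (rsubmx theta) = 0 by rewrite !row_mx0.
rewrite -[LHS]vec_mxK.
suff -> : vec_mx (lsubmx (rsubmx theta)) = 0 by rewrite linear0.
apply/row_matrixP => j; rewrite -[LHS]vec_mxK -[vec_mx _]/(W_mid theta j) mid0.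
by rewrite !linear0.
Qed.

Lemma deep_linearE theta z :
  deep_linear theta z
  = ((w_last theta)^T *m weight_prod theta *m z) 0 0.
Proof.
by rewrite -mulmxA mxE; apply: eq_bigr => i _; rewrite [in RHS]mxE.
Qed.

(** * Stationarity in each layer *)

Section Aligned.
Variables (n : nat) (lambda : R) (x : 'I_n -> 'cV[R]_d) (y : 'I_n -> R).
Variable theta : 'rV[R]_(nparams d m K).
Hypothesis theta_aligned : aligned lambda x y theta.

(** The common value of [lambda] times the squared norm of a layer. *)
Let c := - \sum_(i < n)
  n%:R^-1 * ((@logistic R)^`()%classic (y i * deep_linear theta (x i)) * y i)
    * deep_linear theta (x i).

Lemma aligned_first :
  (exists (P : 'cV[R]_m) (u : 'rV[R]_d), lambda *: W_first theta = P *m u) /\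
  lambda * \tr (W_first theta *m (W_first theta)^T) = c.
Proof.
pose P := (w_last theta)^T *m
  foldl (fun A j => W_mid theta j *m A) 1%:M (enum 'I_K.-2).
have [|k l h z|[u uE] ?] :=
  aligned_block (P := P) (M := 1%:M) theta_aligned (W_firstE theta).
- by move=> z; rewrite deep_linearE /weight_prod foldl_mulmx mul1mx mulmxA.
- rewrite deep_linearE /weight_prod foldl_mulmx mul1mx mulmxA W_firstD.
  rewrite W_first_delta w_lastD w_last_first scaler0 addr0; congr (_ 0 0).
  congr (_ *m _ *m _ *m _); apply: eq_in_foldl => A i _.
  by rewrite W_midD W_mid_first scaler0 addr0.
by split=> //; exists P^T, u.
Qed.

Lemma aligned_mid j :
  (exists (P : 'cV[R]_m) (u : 'rV[R]_m), lambda *: W_mid theta j = P *m u) /\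
  lambda * \tr (W_mid theta j *m (W_mid theta j)^T) = c.
Proof.
have [L [N LN]] := foldl_mulmx_factor (W_mid theta) (W_first theta)
  (enum_uniq 'I_K.-2) (mem_enum 'I_K.-2 j).
(* [P] collects the layers after the chosen one, and [N] those before it. *)
pose P := (w_last theta)^T *m L.
have [|k l h z|[u uE] ?] :=
  aligned_block (P := P) (M := N) theta_aligned (W_midE theta j).
- by move=> z; rewrite deep_linearE /weight_prod LN // !mulmxA.
- rewrite deep_linearE /weight_prod W_firstD W_first_rshift scaler0 addr0.
  rewrite w_lastD w_last_mid scaler0 addr0 LN; last first.
    by move=> i /negPf ij; rewrite W_midD W_mid_delta ij scaler0 addr0.
  by rewrite W_midD W_mid_delta eqxx !mulmxA.
by split=> //; exists P^T, u.
Qed.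

(** The output vector is treated as a [1 x m] matrix with trivial left factor [1%:M]; only the norm
    identity is kept, since a single row has rank at most one anyway. *)
Lemma aligned_last :
  lambda * \tr ((w_last theta)^T *m ((w_last theta)^T)^T) = c.
Proof.
have [k l||k l h z|_ ?] := @aligned_block _ _ _ _ _ 1 m _ _ _ _ (w_last theta)^T
  (fun=> last_index) 1%:M (weight_prod theta) theta_aligned.
- by rewrite mxE ord1 w_lastE.
- by move=> z; rewrite deep_linearE mul1mx mulmxA.
- rewrite deep_linearE mul1mx mulmxA ord1 w_lastD w_last_delta.
  rewrite linearD linearZ /= trmx_delta.
  rewrite /weight_prod W_firstD W_first_rshift scaler0 addr0.
  congr ((_ *m _ *m _) 0 0); apply: eq_in_foldl => A i _.
  by rewrite W_midD W_mid_last scaler0 addr0.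
by [].
Qed.

End Aligned.
End Blocks.

(** * From outer products to ranks *)

Lemma rank_scale_outer (F : fieldType) (p q : nat) (a : F) (W : 'M[F]_(p, q))
    (P : 'cV[F]_p) (u : 'rV[F]_q) :
  a != 0 -> a *: W = P *m u -> (\rank W <= 1)%N.
Proof.
move=> a0 WE; rewrite -(mxrank_scale_nz _ a0) WE.
exact: leq_trans (mxrankM_maxr _ _) (rank_leq_row _).
Qed.

(** Positivity of [lambda] matters: if [lambda = 0] and all [x i = 0], every [theta] is aligned.
    Since [theta = 0] is aligned with all ranks zero, rank one means at most one in general and
    exactly one for nonzero [theta]. *)
Theorem lemma1 (R : realType) (d m K n : nat) (lambda : R)
    (x : 'I_n -> 'cV[R]_d) (y : 'I_n -> R)
    (theta : 'rV[R]_(nparams d m K))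
    (K_ge2 : (2 <= K)%N) (n_gt0 : (0 < n)%N)
    (lambda_gt0 : 0 < lambda)
    (x_le1 : forall i : 'I_n, l2norm (x i) <= 1)
    (y_pm1 : forall i : 'I_n, y i = -1 \/ y i = 1)
    (theta_aligned : aligned lambda x y theta) :
  ((\rank (W_first theta) <= 1)%N
    /\ (forall j : 'I_K.-2, (\rank (W_mid theta j) <= 1)%N))
  /\ (theta <> 0 ->
      \rank (W_first theta) = 1%N
      /\ (forall j : 'I_K.-2, \rank (W_mid theta j) = 1%N)).
Proof.
have lambda0 : lambda != 0 by rewrite gt_eqF.
have [[P1 [u1 first_outer]] first_norm] := aligned_first theta_aligned.
have mid := aligned_mid theta_aligned.
have last_norm := aligned_last theta_aligned.
have rank_first := rank_scale_outer lambda0 first_outer.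
have rank_mid j : (\rank (W_mid theta j) <= 1)%N.
  by have [[P [u outer]] _] := mid j; exact: rank_scale_outer outer.
set c := - _ in first_norm mid last_norm.
(* Whether a layer vanishes is decided by [c] alone, hence simultaneously for all layers. *)
have norm_eq0 p q (W : 'M[R]_(p, q)) :
    lambda * \tr (W *m W^T) = c -> (W == 0) = (c == 0).
  by move=> <-; rewrite mulf_eq0 (negPf lambda0) mxtrace_mul_tr_eq0.
split=> // theta_neq0.
have c_neq0 : c != 0.
  apply/eqP => c0; apply: theta_neq0; apply: blocks_eq0.
  - by apply/eqP; rewrite (norm_eq0 _ _ _ first_norm) c0.
  - by move=> j; apply/eqP; rewrite (norm_eq0 _ _ _ (mid j).2) c0.
  - apply: trmx_inj; rewrite linear0; apply/eqP.
    by rewrite (norm_eq0 _ _ _ last_norm) c0.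
split=> [|j]; apply/eqP; rewrite eqn_leq lt0n mxrank_eq0.
- by rewrite rank_first (norm_eq0 _ _ _ first_norm).
- by rewrite rank_mid (norm_eq0 _ _ _ (mid j).2).
Qed.
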